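(* Let $F_n$ be the free group on $n \geq 2$ generators. Let $Y=Y'/\!\equiv$ be the space of coset partitions of $F_n$ modulo the equivalence relation $P\equiv P' \Leftrightarrow d(P,P')=0$, and let $\rho$ be the function on $Y\times Y$ induced by $d$. Then $Y$ is a metric space with metric $\rho$, and $Y$ is topologically discrete, i.e. every point of $Y$ is isolated in the topology induced by $\rho$.
   Context: A coset partition of $F_n$ is a finite family $\{H_i\alpha_i\}_{i=1}^{s}$ of right cosets of subgroups $H_i$ ($\alpha_i\in F_n$) that are pairwise disjoint and whose union is $F_n$. $Y'$ is the set of all coset partitions $P=\{H_i\alpha_i\}_{i=1}^{s}$ of $F_n$ with all $H_i$ of finite index $d_i>1$, indexed so that $1<d_1\le\dots\le d_s$ (the indexing, including the order among equal indices, is part of the data). $P$ is identified with the $s$-tuple $(H_s,H_{s-1},\dots,H_1)$: $H_s$ is in the first place, $H_{s-1}$ in the second place, and so on. For $P=\{H_i\alpha_i\}_{i=1}^{s}$ and $P'=\{K_i\beta_i\}_{i=1}^{t}$ in $Y'$, with tuples $(H_s,\dots,H_1)$ and $(K_t,\dots,K_1)$, define $d(P,P')=2^{-k}$ if $k$ is the first place at which the two tuples differ, and $d(P,P')=0$ if the tuples coincide (i.e. $t=s$ and $H_i=K_i$ for all $1\le i\le s$). *)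

(* Defs.v *)
From HB Require Import structures.
From mathcomp Require Import all_boot all_order all_algebra.
From mathcomp Require Import finmap.
From mathcomp Require Import all_classical all_reals topology.

Set Implicit Arguments.
Unset Strict Implicit.
Unset Printing Implicit Defensive.

Import Order.TTheory GRing.Theory Num.Theory.

Local Open Scope classical_set_scope.
Local Open Scope quotient_scope.

Section FreeGroup.
Variable n : nat.

(* [(i, false)] is the generator [x_i] and [(i, true)] its formal inverse. *)
Definition letter : Type := 'I_n * bool.

Definition flip (a : letter) : letter := (a.1, ~~ a.2).

Definition reduced (w : seq letter) : bool :=
  sorted (fun a b => b != flip a) w.

(* The free group on ['I_n]: reduced words, multiplied by concatenation
   followed by cancellation. *)
Record freeGroup : Type := FreeWord { word : seq letter; _ : reduced word }.
HB.instance Definition _ := [isSub for word].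
HB.instance Definition _ := [Choice of freeGroup by <:].

(* Left multiplication of a reduced word by one letter. *)
Definition push (a : letter) (w : seq letter) : seq letter :=
  if w is b :: w' then if b == flip a then w' else a :: w else [:: a].

Lemma flipK : involutive flip.
Proof. by case=> i b; rewrite /flip /= negbK. Qed.

Lemma reduced_push a w : reduced w -> reduced (push a w).
Proof.
case: w => //= b w pw; case: ifP => [_|/negbT ba]; first exact: path_sorted pw.
by rewrite /reduced /= ba.
Qed.

Lemma reduced_foldr u v : reduced v -> reduced (foldr push v u).
Proof. by move=> rv; elim: u => //= a u; exact: reduced_push. Qed.

Lemma pushK a w : reduced w -> push (flip a) (push a w) = w.
Proof.
case: w => [|b w] /=; first by rewrite flipK eqxx.
case: ifP => [/eqP-> |_] pw; last by rewrite /= flipK eqxx.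
by case: w pw => //= c w /andP[/negPf ->].
Qed.

Lemma foldr_push x a w : reduced x -> reduced w ->
  foldr push x (push a w) = push a (foldr push x w).
Proof.
move=> rx; case: w => //= b w pw; case: ifP => // /eqP->.
by rewrite -{1}(flipK a) pushK //; exact: reduced_foldr.
Qed.

Lemma foldr_pushr w : reduced w -> foldr push [::] w = w.
Proof.
elim: w => //= a w IHw pw; rewrite IHw; last exact: path_sorted pw.
by case: w pw {IHw} => //= b w /andP[/negPf ->].
Qed.

Lemma reduced_inv w : reduced w -> reduced (rev (map flip w)).
Proof.
rewrite /reduced rev_sorted sorted_map; apply: sub_sorted => a b /=.
by rewrite flipK eq_sym.
Qed.

Definition free_one : freeGroup := @FreeWord [::] isT.
Definition free_mul (u v : freeGroup) : freeGroup :=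
  FreeWord (reduced_foldr (val u) (valP v)).
Definition free_inv (u : freeGroup) : freeGroup :=
  FreeWord (reduced_inv (valP u)).

Lemma free_mulA : associative free_mul.
Proof.
move=> [u ru] [v rv] [w rw]; apply: val_inj => /=.
by elim: u {ru} => //= a u ->; rewrite foldr_push //; exact: reduced_foldr.
Qed.

Lemma free_mul1 : left_id free_one free_mul.
Proof. by move=> u; exact: val_inj. Qed.

Lemma free_mulr1 : right_id free_one free_mul.
Proof. by move=> u; apply: val_inj; apply: foldr_pushr (valP u). Qed.

Lemma free_mulV : left_inverse free_one free_inv free_mul.
Proof.
move=> [u ru]; apply: val_inj => /=.
elim: u ru => //= a u IHu pu.
by rewrite rev_cons foldr_rcons /= flipK eqxx IHu //; exact: path_sorted pu.
Qed.

Lemma free_mulrV : right_inverse free_one free_inv free_mul.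
Proof.
move=> u; have {1}-> : u = free_inv (free_inv u); last exact: free_mulV.
apply: val_inj => /=.
by rewrite map_rev revK -map_comp map_id_in // => a _ /=; rewrite flipK.
Qed.

HB.instance Definition _ := isGroup.Build freeGroup
  free_mulA free_mul1 free_mulr1 free_mulV free_mulrV.

Definition gen (i : 'I_n) : freeGroup := @FreeWord [:: (i, false)] isT.

End FreeGroup.

Section UniversalProperty.
Variables (n : nat) (G : groupType) (f : 'I_n -> G).
Local Open Scope group_scope.

Definition letter_val (a : letter n) : G := if a.2 then (f a.1)^-1 else f a.1.

Definition free_lift (u : freeGroup n) : G :=
  foldr (fun a x => letter_val a * x) 1 (val u).

Lemma free_liftM : {morph free_lift : u v / u * v}.
Proof.
move=> [u ru] [v rv]; rewrite /free_lift /=.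
have lvV a : letter_val (flip a) = (letter_val a)^-1.
  by case: a => i [] /=; rewrite /letter_val /= ?invgK.
have pushE a w : foldr (fun a x => letter_val a * x) 1 (push a w) =
    letter_val a * foldr (fun a x => letter_val a * x) 1 w.
  by case: w => //= b w; case: ifP => // /eqP->; rewrite lvV mulVKg.
by elim: u {ru} => [|a u IHu] /=; rewrite ?mul1g // pushE IHu mulgA.
Qed.

Lemma free_lift_gen i : free_lift (gen i) = f i.
Proof. by rewrite /free_lift /= mulg1. Qed.

Lemma free_lift_uniq (h : freeGroup n -> G) :
  {morph h : u v / u * v} -> (forall i, h (gen i) = f i) -> h =1 free_lift.
Proof.
move=> hM hg; have h1 : h 1 = 1.
  by apply: (mulgI (h 1)); rewrite -hM !mulg1.
have hV u : h u^-1 = (h u)^-1.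
  by apply: (mulgI (h u)); rewrite -hM !mulgV.
case=> w rw; rewrite /free_lift /=.
elim: w rw => [|a w IHw] rw /=; first by rewrite -[RHS]h1; congr h; exact: val_inj.
rewrite -(IHw (path_sorted rw)).
have la : h (@FreeWord _ [:: a] isT) = letter_val a.
  case: a {rw} => i [] /=; last exact: hg.
  by rewrite /letter_val /= -hg -hV; congr h; exact: val_inj.
rewrite -la -hM; congr h; apply: val_inj => /=.
by case: w rw {IHw} => //= b w /andP[/negPf ->].
Qed.

End UniversalProperty.

Definition right_coset (G : groupType) (H : set G) (a : G) : set G :=
  [set (h * a)%g | h in H].

Definition right_cosets (G : groupType) (H : set G) : set (set G) :=
  range (right_coset H).

(* Junk value [0] when there are infinitely many cosets. *)
Definition index (G : groupType) (H : set G) : nat :=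
  #|` fset_set (right_cosets H)|.

(* The subgroups [H_1, ..., H_s] are [cp_sub i] for [i = 0, ..., s - 1]. *)
Record cosetPartition (n : nat) : Type := CosetPartition {
  cp_size : nat;
  cp_sub : 'I_cp_size -> set (freeGroup n);
  cp_rep : 'I_cp_size -> freeGroup n;
  cp_group : forall i, group_closed [in cp_sub i];
  cp_finite : forall i, finite_set (right_cosets (cp_sub i));
  cp_index_gt1 : forall i, (1 < index (cp_sub i))%N;
  cp_sorted : forall i j : 'I_cp_size, (i <= j)%N ->
        (index (cp_sub i) <= index (cp_sub j))%N;
  cp_disjoint : trivIset [set: 'I_cp_size]
        (fun i => right_coset (cp_sub i) (cp_rep i));
  cp_cover : \bigcup_(i in [set: 'I_cp_size])
        right_coset (cp_sub i) (cp_rep i) = [set: freeGroup n]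
}.

HB.instance Definition _ n := gen_eqMixin (cosetPartition n).
HB.instance Definition _ n := gen_choiceMixin (cosetPartition n).

(* [(H_s, H_(s-1), ..., H_1)] *)
Definition cp_tuple n (P : cosetPartition n) : seq (set (freeGroup n)) :=
  rev (codom (@cp_sub n P)).

(* The first place, counted from [1], at which [s] and [t] differ; a place
   occupied in only one of the two sequences counts as a difference.  Only
   meaningful for [s != t]. *)
Definition first_diff (T : eqType) (s t : seq T) : nat :=
  (find (fun k => onth s k != onth t k) (iota 0 (maxn (size s) (size t)))).+1.

Section Distance.
Variables (R : realType) (n : nat).
Local Open Scope ring_scope.

Definition cp_dist (P Q : cosetPartition n) : R :=
  if cp_tuple P == cp_tuple Q then 0
  else 2 ^- first_diff (cp_tuple P) (cp_tuple Q).

Definition cp_equiv (P Q : cosetPartition n) : bool := cp_dist P Q == 0.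

Lemma cp_equivE P Q : cp_equiv P Q = (cp_tuple P == cp_tuple Q).
Proof.
rewrite /cp_equiv /cp_dist; case: ifP => _; first exact: eqxx.
by rewrite invr_eq0 expf_eq0 pnatr_eq0 andbF.
Qed.

Lemma cp_equiv_refl : reflexive cp_equiv.
Proof. by move=> P; rewrite cp_equivE. Qed.

Lemma cp_equiv_sym : symmetric cp_equiv.
Proof. by move=> P Q; rewrite !cp_equivE eq_sym. Qed.

Lemma cp_equiv_trans : transitive cp_equiv.
Proof. by move=> Q P S; rewrite !cp_equivE => /eqP->. Qed.

Canonical cp_equiv_equiv :=
  EquivRel cp_equiv cp_equiv_refl cp_equiv_sym cp_equiv_trans.

Definition cpSpace : Type := {eq_quot cp_equiv}.
HB.instance Definition _ := EqQuotient.on cpSpace.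
HB.instance Definition _ := Choice.on cpSpace.

Definition cp_rho : cpSpace -> cpSpace -> R :=
  fun x y => cp_dist (repr x) (repr y).

Lemma cp_rho_pi P Q : cp_rho (\pi_cpSpace P) (\pi_cpSpace Q) = cp_dist P Q.
Proof.
have reprE S : cp_tuple (repr (\pi_cpSpace S)) = cp_tuple S.
  apply/eqP; rewrite -cp_equivE; apply/eqmodP; exact: reprK.
by rewrite /cp_rho /cp_dist !reprE.
Qed.

End Distance.

(* Main.v *)
(* Right translates of a subgroup all have the same density, so the subgroups of a
    coset partition, counted with multiplicity, have densities summing to 1.  Hence the
    tuple of a coset partition cannot be a proper prefix of the tuple of another one:
    the latter would have densities summing to more than 1.  A partition with [s] cosets
    is therefore at distance at least [2^-s] from every other point.  Densities are
    counted in the finite set of cosets of a common finite-index subgroup [N]. *)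
Require Import Defs.
From HB Require Import structures.
From mathcomp Require Import all_boot all_order all_algebra finmap.
From mathcomp Require Import all_classical all_reals topology.
Local Open Scope classical_set_scope.
Local Open Scope ring_scope.

Import Order.TTheory GRing.Theory Num.Theory.

Set Implicit Arguments.
Unset Strict Implicit.
Unset Printing Implicit Defensive.

(** * Counting cosets of a fixed set of finite index *)

Section CosetCount.
Context {G : groupType}.
Implicit Types (N H A : set G) (g h : G).
Local Open Scope group_scope.

Lemma right_cosetM N g h :
  right_coset N (g * h) = right_coset (right_coset N g) h.
Proof.
apply/seteqP; split=> x /=.
  by case=> k Nk <-; exists (k * g); [exists k | rewrite mulgA].
by case=> _ [k Nk <-] <-; exists k; rewrite ?mulgA.
Qed.

Lemma right_coset_inj h : injective (fun A => right_coset A h).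
Proof.
move=> A B AB; suff K (C : set G) : right_coset (right_coset C h) h^-1 = C.
  by rewrite -(K A) AB K.
rewrite -right_cosetM mulgV; apply/seteqP; split=> x /=.
  by case=> k Ck <-; rewrite mulg1.
by move=> Cx; exists x; rewrite ?mulg1.
Qed.

Lemma right_cosetI N1 N2 g :
  right_coset (N1 `&` N2) g = right_coset N1 g `&` right_coset N2 g.
Proof.
apply/seteqP; split=> x /=; first by case=> k [N1k N2k] <-; split; exists k.
by case=> -[k N1k <-] [l N2l /mulIg lk]; exists k => //; split; rewrite // -lk.
Qed.

Lemma finite_right_cosetsT : finite_set (right_cosets [set: G]).
Proof.
apply: (sub_finite_set _ (finite_set1 [set: G])) => _ [g _ <-] /=.
by apply/seteqP; split=> // x _; exists (x * g^-1); rewrite ?mulgVK.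
Qed.

Lemma finite_right_cosetsI N1 N2 : finite_set (right_cosets N1) ->
  finite_set (right_cosets N2) -> finite_set (right_cosets (N1 `&` N2)).
Proof.
move=> fN1 fN2; apply: sub_finite_set (finite_image2 (@setI G) fN1 fN2).
move=> _ [g _ <-].
exists (right_coset N1 g); first by exists g.
by exists (right_coset N2 g); [exists g | rewrite right_cosetI].
Qed.

(** For a finite-index subgroup [N] and a union [A] of its right cosets, this is the density of [A]
    multiplied by the index of [N], so that densities stay in [nat]. *)
Definition coset_count N A : nat := #|` fset_set (right_coset N @` A)|%fset.

Section FiniteIndex.
Variable N : set G.
Hypothesis finN : finite_set (right_cosets N).

Let finNA A : finite_set (right_coset N @` A).
Proof. by apply: sub_finite_set finN => _ [g _ <-]; exists g. Qed.

(** Since [N (a g) = (N a) g], translation by [g] carries the cosets counted for [A] injectively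
    onto those counted for its translate. *)
Lemma coset_count_translate A g : coset_count N (right_coset A g) = coset_count N A.
Proof.
have -> : coset_count N (right_coset A g) =
    #|` fset_set ((fun B => right_coset B g) @` (right_coset N @` A))|%fset.
  congr #|` fset_set _|%fset; apply/seteqP; split=> B.
    by case=> _ [a Aa <-] <-; exists (right_coset N a); [exists a | rewrite right_cosetM].
  by case=> _ [a Aa <-] <-; exists (a * g); [exists a | rewrite right_cosetM].
by rewrite fset_set_image // card_imfset //; exact: right_coset_inj.
Qed.

Lemma coset_count_gt0 A g : A g -> (0 < coset_count N A)%N.
Proof.
move=> Ag; rewrite cardfs_gt0; apply/fset0Pn; exists (right_coset N g).
by rewrite in_fset_set // inE; exists g.
Qed.

(** Summing indicators over a range independent of [A] prepares the exchange of sums below. *)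
Lemma coset_count_indicator A :
  coset_count N A =
  (\sum_(B <- fset_set (right_cosets N)) (B \in right_coset N @` A))%N.
Proof.
rewrite /coset_count -sum1_size.
transitivity (\sum_(B <- fset_set (right_cosets N) | B \in right_coset N @` A) 1)%N.
  rewrite -[RHS]big_filter; apply: perm_big; apply: uniq_perm => //=.
    exact: filter_uniq.
  move=> B; rewrite mem_filter !in_fset_set //.
  apply/idP/idP => [AB|/andP[]//]; rewrite AB /= inE.
  by move: AB; rewrite inE => -[g _ <-]; exists g.
by rewrite big_mkcond; apply: eq_bigr => B _; case: (B \in _).
Qed.

(** Double counting: each [N g] is counted for exactly one [i], the one with [g] in [A i]. *)
Lemma sum_coset_count (I : finType) (A : I -> set G) :
    N 1 -> (forall i g h, N g -> A i h -> A i (g * h)) ->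
    trivIset [set: I] A -> \bigcup_i A i = [set: G] ->
  (\sum_i coset_count N (A i))%N = coset_count N [set: G].
Proof.
move=> N1 NA tA cA; under eq_bigr do rewrite coset_count_indicator.
rewrite exchange_big coset_count_indicator /= !big_seq; apply: eq_bigr => B.
rewrite in_fset_set // inE => -[g _ <-{B}].
have [i _ Aig] : (\bigcup_i A i) g by rewrite cA.
rewrite (bigD1 i) //= big1 => [|j /eqP ji].
  by rewrite addn0 !mem_set //; exists g.
case: (boolP (_ \in _)) => //; rewrite inE => -[h Ajh Nhg].
(* As [1] is in [N], [g] lies in [N g = N h]; stability under [N] then puts [g] in [A j] too,
   against disjointness. *)
have [k Nk kh] : right_coset N h g by rewrite Nhg; exists 1; rewrite ?mul1g.
by case: ji; apply: tA => //; exists g; split=> //; rewrite -kh; exact: NA.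
Qed.

End FiniteIndex.
End CosetCount.

(** * The tuple of a coset partition is never a proper prefix of another *)

Section CosetPartition.
Variable n : nat.
Implicit Types P Q : cosetPartition n.

Lemma cp_sub1 P (i : 'I_(cp_size P)) : cp_sub i 1%g.
Proof. by case: (cp_group i); rewrite inE. Qed.

Lemma cp_subM P (i : 'I_(cp_size P)) g h : cp_sub i g -> cp_sub i h -> cp_sub i (g * h)%g.
Proof.
have [H1 HV] := cp_group i => /mem_set Hg /mem_set Hh; apply: set_mem.
(* [group_closed] gives closure under division, and [g * h = g / (1 / h)]. *)
by rewrite -(invgK h) -(div1g h); apply: (HV) => //; exact: HV.
Qed.

Lemma sum_cp_tuple P (N : set (freeGroup n)) :
    finite_set (right_cosets N) -> N 1%g -> (forall i : 'I_(cp_size P), N `<=` cp_sub i) ->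
  (\sum_(H <- cp_tuple P) coset_count N H)%N = coset_count N [set: freeGroup n].
Proof.
move=> finN N1 NP; rewrite -(sum_coset_count finN N1 _ (@cp_disjoint n P) (cp_cover P)).
  rewrite /cp_tuple (perm_big _ (permEl (perm_rev _))) codomE big_map big_enum /=.
  by apply: eq_bigr => i _; rewrite coset_count_translate.
move=> i g h Ng [k Hk <-]; exists (g * k)%g; last by rewrite mulgA.
by apply: cp_subM => //; exact: NP.
Qed.

Lemma mem_cp_tuple P H : H \in cp_tuple P -> exists i : 'I_(cp_size P), H = cp_sub i.
Proof. by rewrite mem_rev => /codomP. Qed.

Definition cp_meet P : set (freeGroup n) :=
  \big[setI/[set: freeGroup n]]_(H <- cp_tuple P) H.

Lemma cp_meet_sub P H : H \in cp_tuple P -> cp_meet P `<=` H.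
Proof. by move=> PH; rewrite /cp_meet -bigcap_seq; exact: bigcap_inf. Qed.

Lemma finite_cp_meet P : finite_set (right_cosets (cp_meet P)).
Proof.
rewrite /cp_meet big_seq; elim/big_ind: _ => [||H /mem_cp_tuple[i ->]].
- exact: finite_right_cosetsT.
- exact: finite_right_cosetsI.
- exact: cp_finite.
Qed.

(** Every subgroup of [P] occurs in [Q], so the meet of [Q] can measure both partitions. Both sums
    have the same total, hence the entries of [Q] beyond the prefix contribute 0; but a subgroup
    contains [1] and has positive count. *)
Lemma cp_tuple_prefix P Q : prefix (cp_tuple P) (cp_tuple Q) -> cp_tuple P = cp_tuple Q.
Proof.
move=> /prefixP[s Qs]; pose N := cp_meet Q.
have finN : finite_set (right_cosets N) by exact: finite_cp_meet.
have N1 : N 1%g.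
  by rewrite /N /cp_meet -bigcap_seq => H /= /mem_cp_tuple[i ->]; exact: cp_sub1.
have sub R (i : 'I_(cp_size R)) : {subset cp_tuple R <= cp_tuple Q} -> N `<=` cp_sub i.
  by move=> RQ; apply: cp_meet_sub; apply: RQ; rewrite mem_rev; exact: codom_f.
have sumP : (\sum_(H <- cp_tuple P) coset_count N H)%N = coset_count N setT.
  by apply: sum_cp_tuple => // i; apply: sub => H PH; rewrite Qs mem_cat PH.
have : (\sum_(H <- cp_tuple Q) coset_count N H)%N = coset_count N setT.
  by apply: sum_cp_tuple => // i; exact: sub.
rewrite Qs big_cat sumP /= -{2}(addn0 (coset_count N setT)) => /addnI.
case: s Qs => [|H s] Qs; first by rewrite cats0.
have [i ->] : exists i : 'I_(cp_size Q), H = cp_sub i.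
  by apply: mem_cp_tuple; rewrite Qs mem_cat mem_head orbT.
rewrite big_cons => /eqP; rewrite addn_eq0.
by rewrite gtn_eqF //; exact: coset_count_gt0 (cp_sub1 i).
Qed.

End CosetPartition.

(** * First differences of sequences *)

Section FirstDifference.
Variable T : eqType.
Implicit Types s t : seq T.

(** Places are counted from 1 in [first_diff] and from 0 in [onth], whence the strict inequality. *)
Lemma lt_first_diff s t k : s != t ->
  (k < Defs.first_diff s t)%N <-> (forall i, (i < k)%N -> onth s i = onth t i).
Proof.
move=> st; rewrite ltnS; split=> [+ i ik|eq_st].
  move=> /(leq_trans ik) /[dup] lti /(before_find 0).
  have ltm := leq_trans lti (find_size _ _); rewrite size_iota in ltm.
  by rewrite nth_iota // => /negbFE/eqP.
rewrite leqNgt; apply/negP => lt.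
(* The search does succeed: agreement up to the larger size would force [s = t]. *)
have nst : has (fun i => onth s i != onth t i) (iota 0 (maxn (size s) (size t))).
  apply: contraNT st => /hasPn eqst; apply/eqP/eq_from_onth_le => i ltim.
  by apply/eqP/negPn/eqst; rewrite mem_iota.
have := nth_find 0 nst; rewrite nth_iota; last by rewrite -[ltnRHS](size_iota 0) -has_find.
by rewrite add0n eq_st ?eqxx.
Qed.

Lemma prefix_onth s t :
  (forall i, (i < size s)%N -> onth s i = onth t i) -> prefix s t.
Proof.
elim: s t => [|x s IHs] [|y t] //= st; first by have := st 0%N isT.
have [<-] := st 0%N isT; rewrite eqxx /=.
by apply: IHs => i; exact: (st i.+1).
Qed.

End FirstDifference.

(** * The metric and its isolated points *)

Section Metric.
Variables (R : realType) (n : nat).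
Implicit Types P Q S : cosetPartition n.

(** This form also covers equal tuples, where [first_diff] has no meaning, and so spares later case
    splits. *)
Lemma cp_dist_lt P Q k : (cp_dist R P Q < 2 ^- k) <->
  (forall i, (i < k)%N -> onth (cp_tuple P) i = onth (cp_tuple Q) i).
Proof.
rewrite /cp_dist; have [->|PQ] := eqVneq; first by split=> // _; rewrite invr_gt0 exprn_gt0.
by rewrite ltf_pV2 ?posrE ?exprn_gt0 // ltr_eXn2l ?ltr1n //; exact: lt_first_diff.
Qed.

Lemma cp_dist_ge0 P Q : 0 <= cp_dist R P Q.
Proof. by rewrite /cp_dist; case: ifP => // _; rewrite invr_ge0 exprn_ge0. Qed.

Lemma cp_dist_sym P Q : cp_dist R P Q = cp_dist R Q P.
Proof.
rewrite /cp_dist /Defs.first_diff eq_sym maxnC.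
by under eq_find do rewrite eq_sym.
Qed.

(** If both distances on the right were below [2 ^- k], the value on the left, [P] and [S] would
    agree through [Q] on the first [k] places, including the one where they differ. *)
Lemma cp_dist_ultra P Q S : cp_dist R P S <= Num.max (cp_dist R P Q) (cp_dist R Q S).
Proof.
rewrite {1}/cp_dist; case: ifPn => [_|PS]; first by rewrite le_max cp_dist_ge0.
rewrite leNgt gt_max; apply/negP => /andP[/cp_dist_lt PQ /cp_dist_lt QS].
suff /(lt_first_diff _ PS) : forall i, (i < Defs.first_diff (cp_tuple P) (cp_tuple S))%N ->
  onth (cp_tuple P) i = onth (cp_tuple S) i by rewrite ltnn.
by move=> i lti; rewrite PQ ?QS.
Qed.

Lemma cp_dist_triangle Q P S : cp_dist R P S <= cp_dist R P Q + cp_dist R Q S.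
Proof.
by apply: le_trans (cp_dist_ultra P Q S) _; rewrite ge_max lerDl lerDr !cp_dist_ge0.
Qed.

Lemma cp_dist_eq0 P Q : cp_dist R P Q = 0 <-> cp_tuple P = cp_tuple Q.
Proof.
by split=> /eqP; [rewrite -[_ == 0]/(cp_equiv R P Q) cp_equivE => /eqP | rewrite /cp_dist => ->].
Qed.

(** Below this radius the two tuples agree along the whole of [cp_tuple P], which is therefore a
    prefix of [cp_tuple Q]. *)
Lemma cp_dist_isolated P Q :
  cp_dist R P Q < 2 ^- size (cp_tuple P) -> cp_dist R P Q = 0.
Proof. by move=> /cp_dist_lt/prefix_onth/cp_tuple_prefix/cp_dist_eq0. Qed.

Implicit Types x y z : cpSpace R n.

Lemma cp_rhoxx x : cp_rho x x = 0.
Proof. exact/cp_dist_eq0. Qed.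

Lemma cp_rho_eq0 x y : cp_rho x y = 0 -> x = y.
Proof.
move=> /eqP xy; rewrite -[x]reprK -[y]reprK.
by apply/eqmodP.
Qed.

HB.instance Definition _ := isMetric.Build R (cpSpace R n) cp_rhoxx cp_rho_eq0
  (fun x y => cp_dist_sym (repr x) (repr y))
  (fun y x z => cp_dist_triangle (repr y) (repr x) (repr z)).

End Metric.

Theorem theorem4 (R : realType) (n : nat) (hn : (2 <= n)%N) :
  exists m : Metric.axioms_ R (cpSpace R n),
    let Y : metricType R := Metric.Pack m in
    (forall x y : Y, mdist x y = cp_rho x y)
    /\ (forall x : Y, isolated [set: Y] x).
Proof.
exists (Metric.on (cpSpace R n)); split=> // x; split; first by rewrite inE.
(* With this radius the open ball around [x] is [{x}]. *)
pose e : R := 2 ^- size (cp_tuple (repr x)).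
have e0 : 0 < e by rewrite invr_gt0 exprn_gt0.
exists (ball x e); first exact: nbhsx_ballx.
rewrite setIT ballEmdist; apply/seteqP; split=> y /=.
  by move=> /cp_dist_isolated/cp_rho_eq0.
by move=> ->; rewrite mdistxx.
Qed.
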